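(* Let $n,k$ be positive integers. Let $G$ be a connected planar graph of order $n$ and let $m=|E(G)|$. If $m>3n-2k-9$, then $G$ has at most $k$ cut-edges unless one of the following cases holds: (a) $G$ is isomorphic to a graph $H$ in $\mathcal{H}$; (b) $G$ is isomorphic to a tree of order $k+2$; (c) $G$ is isomorphic to a tree of order $k+3$.
   Context: All graphs are finite and simple. The order of $G$ is $|V(G)|$. A cut-edge of a connected graph is an edge whose deletion increases the number of connected components. For the given positive integer $k$, the class $\mathcal{H}$ is the set of all connected graphs $H$ such that: $H$ has exactly $k+1$ cut-edges $e_1,\dots,e_{k+1}$; and the graph $H-\{e_1,\dots,e_{k+1}\}$ obtained by deleting these edges has $k+2$ components $C_1,\dots,C_{k+2}$ which can be labelled so that $|V(C_i)|=1$ for all $i\in\{1,\dots,k+1\}$ and $C_{k+2}$ is a connected planar graph with the maximum number of edges (i.e. the maximum possible among planar graphs on $|V(C_{k+2})|$ vertices). *)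

(* Defs.v *)
From HB Require Import structures.
From mathcomp Require Import all_boot all_order all_algebra.
From mathcomp Require Import all_classical all_reals all_analysis.

Set Implicit Arguments.
Unset Strict Implicit.
Unset Printing Implicit Defensive.

Import numFieldNormedType.Exports.

Local Open Scope set_scope.

Record sgraph := SGraph {
  vertex :> finType;
  adj : rel vertex;
  adj_sym : symmetric adj;
  adj_irrefl : irreflexive adj }.

Arguments adj {s}.

Definition edges (G : sgraph) : {set {set G}} :=
  [set [set p.1; p.2] | p : G * G & adj p.1 p.2].

Section Subgraphs.
Variable G : sgraph.

Definition del_adj (F : {set {set G}}) : rel G :=
  fun x y => adj x y && ([set x; y] \notin F).

Fact del_adj_sym F : symmetric (del_adj F).
Proof. by move=> x y; rewrite /del_adj adj_sym finset.setUC. Qed.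

Fact del_adj_irrefl F : irreflexive (del_adj F).
Proof. by move=> x; rewrite /del_adj adj_irrefl. Qed.

Definition del_edges (F : {set {set G}}) : sgraph :=
  SGraph (@del_adj_sym F) (@del_adj_irrefl F).

Definition induced_adj (S : {set G}) : rel {x : G | x \in S} :=
  fun x y => adj (val x) (val y).

Fact induced_adj_sym S : symmetric (@induced_adj S).
Proof. by move=> x y; rewrite /induced_adj adj_sym. Qed.

Fact induced_adj_irrefl S : irreflexive (@induced_adj S).
Proof. by move=> x; rewrite /induced_adj adj_irrefl. Qed.

Definition induced_subgraph (S : {set G}) : sgraph :=
  SGraph (@induced_adj_sym S) (@induced_adj_irrefl S).

End Subgraphs.

Definition components (G : sgraph) : {set {set G}} :=
  equivalence_partition (connect (@adj G)) [set: G].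

(* The graph without vertices has no component, hence is not connected. *)
Definition connected_graph (G : sgraph) : Prop := #|components G| = 1.

Definition cut_edges (G : sgraph) : {set {set G}} :=
  [set e in edges G | #|components G| < #|components (del_edges [set e])|].

Definition acyclic (G : sgraph) : Prop :=
  forall c : seq G, 2 < size c -> ~ ucycle adj c.

Definition tree (G : sgraph) : Prop := connected_graph G /\ acyclic G.

Definition isomorphic (G H : sgraph) : Prop :=
  exists2 f : G -> H, bijective f & forall x y, adj (f x) (f y) = adj x y.

(* [arc e] is only constrained on the unit interval and for edges [e].  Its
   orientation is free: [drawing_ends] equates unordered pairs of endpoints. *)
Record plane_drawing (R : realType) (G : sgraph)
    (pos : G -> R * R) (arc : {set G} -> R -> R * R) : Prop := PlaneDrawing {
  drawing_pos_inj : injective pos;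
  drawing_continuous : forall e, e \in edges G ->
    {within `[0%R, 1%R], continuous (arc e)}%classic;
  drawing_arc_inj : forall e, e \in edges G ->
    {in `[0, 1]%R &, injective (arc e)};
  drawing_ends : forall e, e \in edges G ->
    [set arc e 0%R; arc e 1%R]%classic = (pos @` [set` e])%classic;
  drawing_avoids_vertices : forall e (t : R) v, e \in edges G ->
    t \in `]0, 1[%R -> arc e t <> pos v;
  drawing_no_crossing : forall e f (s t : R), e \in edges G -> f \in edges G ->
    e != f -> s \in `]0, 1[%R -> t \in `]0, 1[%R -> arc e s <> arc f t }.

Definition planar (R : realType) (G : sgraph) : Prop :=
  exists pos arc, @plane_drawing R G pos arc.

Definition max_planar (R : realType) (G : sgraph) : Prop :=
  planar R G /\
  forall G' : sgraph, #|G'| = #|G| -> planar R G' -> #|edges G'| <= #|edges G|.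

(* The components C_1, ..., C_(k+2) are indexed from 0, so C_(k+2) is
   [C ord_max]. *)
Definition class_H (R : realType) (k : nat) (H : sgraph) : Prop :=
  let H' := del_edges (cut_edges H) in
  [/\ connected_graph H,
      #|cut_edges H| = k.+1 &
      exists C : 'I_k.+2 -> {set H'},
        [/\ injective C,
            [set C i | i : 'I_k.+2] = components H',
            forall i : 'I_k.+2, i < k.+1 -> #|C i| = 1,
            connected_graph (induced_subgraph (C ord_max)) &
            max_planar R (induced_subgraph (C ord_max))]].

(* Main.v *)
Require Import Defs.
From mathcomp Require Import all_boot all_order all_algebra.
From mathcomp Require Import all_classical all_reals all_analysis.
From mathcomp Require Import seq path fintype fingraph bigop finset zify lra.
From Stdlib Require Import Btauto.

(** Deleting the [c] cut-edges of a connected graph [G] of order [n] leaves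
    [c + 1] components without cut-edges, so each of them is a single vertex
    or has order at least 3.  A planar graph of order [q >= 3] has at most
    [3q - 6] edges; summing over the components gives
    [m <= 3n - 2c - 3 - 3t], where [t] counts the components with more than
    one vertex.  Under [m > 3n - 2k - 9] and [c > k] only two cases survive.
    Either [t = 0], every edge is a cut-edge, and [G] is a tree with [k + 1]
    or [k + 2] edges; or [t = 1], [c = k + 1] and equality holds everywhere,
    so that the nontrivial component, of order [q], has [3q - 6] edges, the
    maximum for a planar graph ([class_H_intro]).

    What carries the proof is the bound [3q - 6] for graphs drawn with
    arbitrary continuous arcs.  It is obtained without faces and without the
    Jordan curve theorem, from the van Kampen obstruction modulo 2.  If [a]
    and [b] are the arcs of two edges without common end, then [a s - b t]
    never vanishes on the unit square, hence winds zero times around the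
    origin along the boundary of the square.  Each side of the square
    contributes the winding of one arc around an end of the other, and
    counting crossings of the positive x-axis modulo 2 turns this into a
    linear relation over the booleans ([planar_Z2_planar]).  Solvability of
    this system of relations, called [Z2_planar] here, passes to subgraphs
    and to contractions ([Z2_planar_contract]), and fails for the complete
    graph on five vertices ([not_Z2_planar_K5]).  Mader's induction then
    applies ([darts_Z2_planar]): contract an edge whose ends have at most two
    common neighbours; if there is none, a graph with more than [3q - 6]
    edges, thinned to exactly [3q - 5], has a vertex of degree 4 or 5 whose
    neighbourhood is dense enough to produce that complete graph. *)

Set Implicit Arguments.
Unset Strict Implicit.
Unset Printing Implicit Defensive.

(** * Edges *)

Section Edges.
Local Open Scope set_scope.

Lemma eq_set2 (V : finType) (a b x y : V) :
  ([set a; b] == [set x; y]) = (a == x) && (b == y) || (a == y) && (b == x).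
Proof.
apply/eqP/orP => [/setP E|[] /andP[/eqP-> /eqP->]]; [|by []|by rewrite setUC].
have := E a; have := E b; have := E x; have := E y; rewrite !inE !eqxx /= !orbT.
rewrite !(eq_sym x) !(eq_sym y).
case: (eqVneq a x) (eqVneq b y) (eqVneq a y) (eqVneq b x) => [?|?] [?|?] [?|?] [?|?];
  by [left|right|].
Qed.

Lemma mem_edges (G : sgraph) (x y : G) : ([set x; y] \in edges G) = adj x y.
Proof.
apply/imsetP/idP => [[[a b]]|xy]; last by exists (x, y); rewrite ?inE.
by rewrite inE /= => ab /eqP; rewrite eq_set2 => /orP[] /andP[/eqP-> /eqP->] //;
  rewrite adj_sym.
Qed.

Lemma edgesP (G : sgraph) (f : {set G}) :
  reflect (exists x y, adj x y /\ f = [set x; y]) (f \in edges G).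
Proof.
apply: (iffP imsetP) => [[[a b]]|[x [y [xy ->]]]]; last by exists (x, y); rewrite ?inE.
by rewrite inE => ab ->; exists a, b.
Qed.

End Edges.

(** * The van Kampen obstruction modulo 2 *)

(** Brings exclusive disjunctions into the form that [btauto] decides. *)
Lemma addb_xorb a b : a (+) b = xorb a b.
Proof. by case: a; case: b. Qed.

Lemma addb_solve (a b c : bool) : a (+) b = c -> b = a (+) c.
Proof. by move<-; rewrite addbA addbb. Qed.

Section Z2Planar.
Local Open Scope set_scope.
Variable V : finType.
Implicit Types (e : rel V) (S : {set V}).

(** The parity form of the vanishing of the van Kampen obstruction.  In a
    drawing, [h x y] tells in which half-plane [y] lies as seen from [x], and
    [w x y z] is the parity of the number of times the arc of the edge [x y]
    crosses the ray that starts at [z] in the direction of the positive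
    x-axis. *)
Definition Z2_planar e : Prop :=
  exists (h : rel V) (w : V -> V -> V -> bool),
    (forall x y, x != y -> h x y = ~~ h y x) /\
    (forall i j k l, uniq [:: i; j; k; l] -> e i j -> e k l ->
       w i j k (+) w i j l (+) w k l i (+) w k l j =
       h i k (+) h i l (+) h j k (+) h j l).

Lemma Z2_planar_sub e e' : subrel e' e -> Z2_planar e -> Z2_planar e'.
Proof.
move=> sub [h [w [hN hw]]]; exists h, w; split=> // i j k l u ij kl.
by apply: hw => //; apply: sub.
Qed.

(** The vertex [v] is merged into [u]; it stays in the type as an isolated
    vertex, so that contracting does not change the carrier. *)
Definition contract e u v : rel V := fun x y =>
  [&& x != v, y != v, x != y &
      [|| e x y, (x == u) && e v y | (y == u) && e x v]].

Lemma contract_sym e u v : symmetric e -> symmetric (contract e u v).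
Proof.
move=> es x y; rewrite /contract (es y x) (es v x) (es y v) (eq_sym y x).
by case: (x != v); case: (y != v); case: (x != y); case: (e x y) => //=;
  rewrite orbC.
Qed.

Lemma contract_irrefl e u v : irreflexive (contract e u v).
Proof. by move=> x; rewrite /contract eqxx !andbF. Qed.

(** An edge of the contraction that is not an edge of the graph is the path
    through [v]; its winding is the sum of the windings of its two edges.  The
    relation for such an edge is the sum of two relations of the graph, in
    which the terms at [v] cancel. *)
Lemma Z2_planar_contract e u v : symmetric e -> e u v ->
  Z2_planar e -> Z2_planar (contract e u v).
Proof.
move=> es euv [h [w [hN hw]]].
have evu : e v u by rewrite es.
pose w' x y z := if e x y then w x y z else w x v z (+) w v y z.
have split x y : [|| e x y, (x == u) && e v y | (y == u) && e x v] ->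
    e x y \/ [/\ e x y = false, e x v, e v y & u \in [:: x; y]].
  case: (e x y) => /=; first by left.
  by case/orP => /andP[/eqP-> Huv]; right; rewrite !inE eqxx ?orbT.
exists h, w'; split=> // i j k l /[dup] U.
rewrite /= !inE !negb_or.
move=> /and4P[/and3P[ij ik il] /andP[jk jl] kl _].
move=> /and4P[iv jv _ /split Eij] /and4P[kv lv _ /split Ekl].
have glue x y k1 l1 : uniq [:: x; y; k1; l1] -> v \notin [:: x; y; k1; l1] ->
    e x v -> e v y -> e k1 l1 ->
    (w x v k1 (+) w v y k1) (+) (w x v l1 (+) w v y l1) (+)
      w k1 l1 x (+) w k1 l1 y = h x k1 (+) h x l1 (+) h y k1 (+) h y l1.
  rewrite /= !inE !negb_or.
  move=> /and4P[/and3P[xy xk xl] /andP[yk yl] k1l _].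
  move=> /and4P[vx vy vk vl] exv evy ekl.
  have := hw x v k1 l1; have := hw v y k1 l1.
  rewrite /= !inE !negb_or vy vk vl yk yl k1l xk xl eq_sym vx /=.
  move=> /(_ isT evy ekl) E2 /(_ isT exv ekl) /addb_solve E1.
  move: E2; rewrite E1 => /addb_solve ->.
  by rewrite !addb_xorb; btauto.
have nv : v \notin [:: i; j; k; l].
  by rewrite !inE !negb_or !(eq_sym v) iv jv kv lv.
have Ukl : uniq [:: k; l; i; j] by rewrite (@uniq_catC _ [:: k; l] [:: i; j]).
have nv' : v \notin [:: k; l; i; j].
  by rewrite !inE !negb_or !(eq_sym v) iv jv kv lv.
have hs : h i k (+) h i l (+) h j k (+) h j l =
          h k i (+) h k j (+) h l i (+) h l j.
  rewrite (hN _ _ ik) (hN _ _ il) (hN _ _ jk) (hN _ _ jl) !addb_xorb.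
  by btauto.
rewrite /w'; case: Eij => [eij|[nij eiv evj uij]].
  rewrite eij; case: Ekl => [ekl|[nkl ekv evl ukl]]; first by rewrite ekl; apply: hw.
  by rewrite nkl hs -(glue k l i j) // !addb_xorb; btauto.
case: Ekl => [ekl|[_ _ _ ukl]]; first by rewrite nij ekl glue.
(* Two disjoint edges cannot both be new: each new edge contains [u]. *)
have : ~~ has (mem [:: i; j]) [:: k; l].
  by move: U; rewrite (@cat_uniq _ [:: i; j]) => /and3P[].
by move/hasP; case; exists u.
Qed.

(** Add the relations of all pairs of disjoint edges.  The three pairs inside
    four given vertices contribute the windings [t] of the four triangles, and
    1 on the right, since [h] is antisymmetric.  Each triangle lies in two of
    the five quadruples, so the sum over all quadruples reads [0 = 1]. *)
Lemma not_Z2_planar_K5 e a b c d f : uniq [:: a; b; c; d; f] ->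
  pairwise e [:: a; b; c; d; f] -> ~ Z2_planar e.
Proof.
move=> U E [h [w [hN hw]]].
pose t i j k := w i j k (+) w i k j (+) w j k i.
have K4 i j k l : uniq [:: i; j; k; l] -> pairwise e [:: i; j; k; l] ->
    t i j k (+) t i j l (+) t i k l (+) t j k l = true.
  move=> U4; move: (U4); rewrite /= !inE !negb_or !andbT.
  move=> /and3P[/and3P[ij ik il] /andP[jk jl] kl].
  move=> /and3P[/and3P[eij eik eil] /andP[ejk ejl] ekl].
  have := hw i j k l; have := hw i k j l; have := hw i l j k.
  rewrite /= !inE !negb_or !(eq_sym l) !(eq_sym k j) ij ik il jk jl kl /=.
  move=> /(_ isT eil ejk) E1 /(_ isT eik ejl) E2 /(_ isT eij ekl) E3.
  transitivity ((w i j k (+) w i j l (+) w k l i (+) w k l j) (+)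
    (w i k j (+) w i k l (+) w j l i (+) w j l k) (+)
    (w i l j (+) w i l k (+) w j k i (+) w j k l)).
    by rewrite /t !addb_xorb; btauto.
  rewrite E1 E2 E3 (hN k j) 1?eq_sym // (hN l j) 1?eq_sym //.
  by rewrite (hN l k) 1?eq_sym // !addb_xorb; btauto.
move: U E; rewrite /= !inE !negb_or !andbT.
move=> /and4P[/and4P[ab ac ad af] /and3P[bc bd bf] /andP[cd cf] df].
move=> /and4P[/and4P[eab eac ead eaf] /and3P[ebc ebd ebf] /andP[ecd ecf] edf].
have := K4 a b c d; have := K4 a b c f; have := K4 a b d f.
have := K4 a c d f; have := K4 b c d f.
rewrite /= !inE !negb_or ab ac ad af bc bd bf cd cf df.
rewrite eab eac ead eaf ebc ebd ebf ecd ecf edf /=.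
move=> /(_ isT isT) E1 /(_ isT isT) E2 /(_ isT isT) E3.
move=> /(_ isT isT) E4 /(_ isT isT) E5.
have : true (+) true (+) true (+) true (+) true = false; last by [].
rewrite -{1}E1 -{1}E2 -{1}E3 -{1}E4 -E5 !addb_xorb; btauto.
Qed.

(** Contracting the edge [a b] of the rim leaves the complete graph on
    [v], [h], [a], [c] and [d]. *)
Lemma not_Z2_planar_double_wheel e v h a b c d : symmetric e ->
  uniq [:: v; h; a; b; c; d] ->
  pairwise e [:: v; h; a] -> all (e v) [:: b; c; d] -> all (e h) [:: b; c; d] ->
  e a b -> e b c -> e c d -> e d a -> ~ Z2_planar e.
Proof.
move=> es U /=; rewrite !andbT => /andP[/andP[vh va] ha].
move=> /and3P[vb vc vd] /and3P[hb hc hd] ab bc cd da.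
move=> /(Z2_planar_contract es ab); move: U; rewrite /= !inE !negb_or !andbT.
move=> /and5P[/and5P[nvh nva nvb nvc nvd] /and4P[nha nhb nhc nhd]].
move=> /and3P[nab nac nad] /andP[nbc nbd] ncd.
apply: (@not_Z2_planar_K5 _ v h a c d).
  by rewrite /= !inE !negb_or nvh nva nvc nvd nha nhc nhd nac nad ncd.
rewrite /= /contract !(eq_sym c b) !(eq_sym d b).
rewrite nvh nva nvb nvc nvd nha nhb nhc nhd nab nac nad nbc nbd ncd /=.
by rewrite vh va vc vd ha hc hd cd (es a d) da eqxx bc /= !orbT.
Qed.

(** * The edge bound *)

(** Twice the number of edges inside [S], counted as a sum of degrees. *)
Definition darts S e := \sum_(x in S) #|[set y in S | e x y]|.

(** Contracting [u v] loses that edge and, for every common neighbour of [u]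
    and [v], one of two edges that become parallel. *)
Lemma darts_contract S e u v : symmetric e -> irreflexive e ->
  u \in S -> v \in S -> e u v ->
  darts S e <= darts (S :\ v) (contract e u v) +
    2 * #|[set y in S | e u y & e v y]|.+1.
Proof.
move=> es ei uS vS euv.
have nuv : u != v by apply: contraTneq euv => ->; rewrite ei.
have nvu : v != u by rewrite eq_sym.
have uSv : u \in S :\ v by rewrite !inE nuv.
set Nuv := [set y in S | e u y & e v y].
have Hu : #|[set y in S | e v y]| + #|[set y in S | e u y]| <=
    #|[set y in S :\ v | contract e u v u y]| + 2 + #|Nuv|.
  rewrite -cardsUI; apply: leq_add; last first.
    by apply: subset_leq_card; apply/subsetP => y; rewrite !inE; lia.
  have -> : 2 = #|[set u; v]| by rewrite cards2 nuv.
  apply: leq_trans (leq_card_setU _ _).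
  apply: subset_leq_card; apply/subsetP => y; rewrite !inE /contract nuv eqxx.
  by rewrite !(eq_sym u); case: eqP => //; case: eqP => //= _ _; lia.
have Hx x : x \in S :\ v :\ u -> #|[set y in S | e x y]| <=
    #|[set y in S :\ v | contract e u v x y]| + (e u x && e v x).
  rewrite !inE (es u) (es v) => /and3P[xu xv xS].
  have sub y : y != v -> e x y -> contract e u v x y.
    move=> yv exy; rewrite /contract xv yv exy /= andbT.
    by apply: contraTneq exy => ->; rewrite ei.
  have [exv|exv] := boolP (e x v); last first.
    apply: leq_trans (leq_addr _ _); apply: subset_leq_card.
    apply/subsetP => y; rewrite !inE => /andP[yS exy].
    have yv : y != v by apply: contraNneq exv => <-.
    by rewrite yv yS sub.
  have [exu|exu] := boolP (e x u).
    apply: leq_trans (_ : #|v |: [set y in S :\ v | contract e u v x y]| <= _).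
      apply: subset_leq_card; apply/subsetP => y; rewrite !inE.
      by case: eqP => [//|/eqP yv] /andP[-> /sub ->].
    by rewrite cardsU1 !inE eqxx addnC.
  rewrite addn0.
  have uN : u \in [set y in S :\ v | contract e u v x y].
    by rewrite !inE nuv uS /contract xv nuv xu eqxx exv !orbT.
  rewrite (cardsD1 u) [in leqRHS](cardsD1 u) uN inE (negPf exu) andbF add0n.
  rewrite (cardsD1 v) !inE vS exv nvu add1n ltnS.
  apply: subset_leq_card; apply/subsetP => y; rewrite !inE.
  by case/and4P => yv -> -> /sub ->; rewrite ?yv.
have Ht : \sum_(x in S :\ v :\ u) (e u x && e v x) <= #|Nuv|.
  rewrite -sum1_card [leqLHS]big_mkcond [leqRHS]big_mkcond /=.
  apply: leq_sum => x _; rewrite !inE; case: (x \in S) => /=; last by rewrite !andbF.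
  by rewrite !andbT; case: ifP => //; case: (_ && _).
rewrite /darts (big_setD1 v) //= (big_setD1 u) //= [in leqRHS](big_setD1 u) //=.
have := leq_sum (index_enum V) Hx; rewrite big_split /=.
move: Hu Ht; lia.
Qed.

Lemma darts_del S e v : symmetric e -> (forall x, x \in S -> ~~ e v x) ->
  darts S e = darts (S :\ v) e.
Proof.
move=> es iso; have [vS|vS] := boolP (v \in S); last first.
  by rewrite (_ : S :\ v = S) //; apply/setP => x; rewrite !inE;
     case: eqP vS => // -> /negPf ->.
rewrite /darts (big_setD1 v) //= (_ : [set y in S | e v y] = set0); last first.
  by apply/setP => x; rewrite !inE; case: (boolP (x \in S)) => // /iso /negPf ->.
rewrite cards0 add0n; apply: eq_bigr => x; rewrite !inE => /andP[_ xS].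
congr #|pred_of_set _|; apply/setP => y; rewrite !inE.
by case: eqP => // ->; rewrite es (negPf (iso _ xS)) andbF.
Qed.

Lemma darts_le_sq S e : irreflexive e -> darts S e <= #|S| * #|S|.-1.
Proof.
move=> ei; rewrite /darts -sum_nat_const; apply: leq_sum => x xS.
rewrite [in leqRHS](cardsD1 x) xS /=; apply: subset_leq_card.
apply/subsetP => y; rewrite !inE => /andP[-> exy]; rewrite andbT.
by apply: contraTneq exy => ->; rewrite ei.
Qed.

(** Deleting edges one at a time, the number of darts drops by 2 at each
    step. *)
Lemma thin_darts S e M : symmetric e -> irreflexive e -> M < darts S e ->
  exists2 e', subrel e' e & [/\ symmetric e', irreflexive e' & M < darts S e' <= M + 2].
Proof.
have [m] := ubnP (darts S e); elim: m e => // m IH e /ltnSE le_m es ei lt_M.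
have [le2|gt2] := leqP (darts S e) (M + 2).
  by exists e => //; split=> //; apply/andP.
have [x xS] : exists2 x, x \in S & 0 < #|[set y in S | e x y]|.
  apply/exists_inP; apply: contraTT lt_M => /exists_inPn H.
  by rewrite -leqNgt /darts big1 // => x /H; lia.
case/card_gt0P => y; rewrite inE => /andP[yS exy].
have nxy : x != y by apply: contraTneq exy => ->; rewrite ei.
pose e' := [rel a b | e a b && ((a, b) \notin [:: (x, y); (y, x)])].
have sub : subrel e' e by move=> a b /andP[].
have es' : symmetric e'.
  move=> a b; rewrite /= es !inE !xpair_eqE !negb_or; congr andb.
  by rewrite andbC ![(_ == x) && _]andbC.
have ei' : irreflexive e' by move=> a; rewrite /= ei.
have De : darts S e = (darts S e' + 2)%N.
  rewrite /darts (big_setD1 x) //= (big_setD1 y) /=; last by rewrite !inE eq_sym nxy.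
  rewrite [in RHS](big_setD1 x) //= [in RHS](big_setD1 y) /=; last first.
    by rewrite !inE eq_sym nxy.
  have nyx : y != x by rewrite eq_sym.
  have Dx : [set z in S | e x z] = y |: [set z in S | e' x z].
    apply/setP => z; rewrite !inE !xpair_eqE eqxx (negPf nxy) /= orbF.
    by case: eqP => //= [->|_]; rewrite ?yS ?exy ?andbT.
  have Dy : [set z in S | e y z] = x |: [set z in S | e' y z].
    apply/setP => z; rewrite !inE !xpair_eqE eqxx (negPf nyx) /=.
    by case: eqP => //= [->|_]; rewrite ?xS ?(es y) ?exy ?andbT.
  have Cx : #|[set z in S | e x z]| = #|[set z in S | e' x z]|.+1.
    by rewrite Dx cardsU1 !inE !xpair_eqE !eqxx /= !andbF.
  have Cy : #|[set z in S | e y z]| = #|[set z in S | e' y z]|.+1.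
    by rewrite Dy cardsU1 !inE !xpair_eqE !eqxx orbT /= !andbF.
  rewrite Cx Cy addn2 !addSn addnS; congr (_ + (_ + _)).+2.
  apply: eq_bigr => z; rewrite !inE => /and3P[zy zx _].
  congr #|pred_of_set _|; apply/setP => a; rewrite !inE !xpair_eqE.
  by rewrite (negPf zy) (negPf zx) andbT.
have [||||e'' sub' H] := IH e'; [lia|exact: es'|exact: ei'|lia|].
by exists e'' => // a b /sub' /sub.
Qed.

(** With four neighbours, [v] and [s] form a complete graph on five vertices.
    With five, the non-adjacent pairs of [s] form a matching; it misses some
    [h] of [s], and the other four elements of [s] contain a 4-cycle, so [v]
    and [s] contain a double wheel with hubs [v] and [h]. *)
Lemma nbhd_not_Z2_planar e v (s : seq V) : symmetric e -> irreflexive e ->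
  uniq s -> 0 < size s <= 5 -> all (e v) s ->
  (forall x, x \in s -> 2 < count (e x) s) -> ~ Z2_planar e.
Proof.
move=> es ei Us ss vs cs.
have nvs : v \notin s by apply/negP => /(allP vs); rewrite ei.
have [s5|s5] := leqP 5 (size s); last first.
  case: s Us ss vs cs nvs s5 => [|a [|b [|c [|d [|? ?]]]]] //= Us ss vs cs nvs _.
  - by have := cs a (mem_head _ _); rewrite ei.
  - by have := cs a (mem_head _ _); rewrite ei; case: (e a b).
  - by have := cs a (mem_head _ _); rewrite ei; case: (e a b); case: (e a c).
  have := cs a; have := cs b; have := cs c; have := cs d.
  rewrite !inE !eqxx !orbT !ei !(es d) !(es c) !(es b).
  move=> /(_ isT) H1 /(_ isT) H2 /(_ isT) H3 /(_ isT) H4.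
  apply: (@not_Z2_planar_K5 _ v a b c d); first by rewrite cons_uniq nvs.
  rewrite pairwise_cons; apply/andP; split; first exact: vs.
  by move: H1 H2 H3 H4; rewrite /= !(es b) !(es c) !(es d); do 6!case: (e _ _).
have [h hs hubh] : exists2 h, h \in s & all (e h) (rem h s).
  case: s Us ss s5 {vs nvs} cs => [|a [|b [|c [|d [|f [|? ?]]]]]] // Us _ _ cs.
  have [x xs deg4] : exists2 x, x \in [:: a; b; c; d; f] &
      3 < count (e x) [:: a; b; c; d; f].
    have := cs a; have := cs b; have := cs c; have := cs d; have := cs f.
    rewrite !inE !eqxx !orbT /= !ei !(es f) !(es d) !(es c) !(es b) !addn0.
    move=> /(_ isT) Hf /(_ isT) Hd /(_ isT) Hc /(_ isT) Hb /(_ isT) Ha.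
    apply/hasP; rewrite /= !ei !(es f) !(es d) !(es c) !(es b).
    by move: Ha Hb Hc Hd Hf; clear; lia.
  exists x; first by [].
  rewrite all_count eqn_leq count_size size_rem //.
  by move: deg4; rewrite (seq.permP (perm_to_rem xs)) /= ei.
have Ps := perm_to_rem hs.
have := perm_uniq Ps; rewrite Us => /esym; move: (perm_size Ps).
have : all (e v) (h :: rem h s) by rewrite -(perm_all _ Ps).
have : forall x, x \in rem h s -> 2 < count (e x) (h :: rem h s).
  by move=> x /mem_rem /cs; rewrite (seq.permP Ps).
have : v \notin h :: rem h s by rewrite -(perm_mem Ps).
move: hubh; case: (rem h s) => [|b [|c [|d [|f [|? ?]]]]] hubh {}nvs {}cs {}vs ss' U';
  try by move: ss s5; rewrite ss' /=.
have [hb hc hd hf] : [/\ e h b, e h c, e h d & e h f].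
  by move: hubh => /= /and5P[-> -> -> -> _].
have {}U' : uniq [:: v; h; b; c; d; f].
  by rewrite cons_uniq U' nvs.
have [vh vb vc vd vf] : [/\ e v h, e v b, e v c, e v d & e v f].
  by move: vs => /= /and5P[-> -> -> -> /andP[->]].
have := cs b; have := cs c; have := cs d; have := cs f.
rewrite !inE !eqxx !orbT /= !(es _ h) hb hc hd hf.
rewrite !ei !(es f) !(es d) !(es c) !addn0.
move=> /(_ isT) Hf /(_ isT) Hd /(_ isT) Hc /(_ isT) Hb.
have : [|| [&& e b c, e c d, e d f & e b f], [&& e b c, e c f, e d f & e b d] |
           [&& e b d, e c d, e c f & e b f]].
  move: Hb Hc Hd Hf; rewrite (es f d) (es f c) (es d c).
  by do 6!case: (e _ _).
by case/or3P => /and4P[E1 E2 E3 E4];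
  [apply: (@not_Z2_planar_double_wheel e v h b c d f)
  |apply: (@not_Z2_planar_double_wheel e v h b c f d)
  |apply: (@not_Z2_planar_double_wheel e v h b d c f)] => //;
  rewrite /= ?vh ?vb ?vc ?vd ?vf ?hb ?hc ?hd ?hf //; try (by rewrite es);
  move: U'; rewrite /= !inE !negb_or ?(eq_sym f d) ?(eq_sym d c);
  do 15?case: (_ == _) => //=.
Qed.

(** The induction deletes an isolated vertex or contracts an edge with at most
    two common neighbours, which costs at most 6 darts.  When neither exists,
    some vertex has degree at most 5, and each of its neighbours has three
    common neighbours with it. *)
Lemma darts_Z2_planar e S : symmetric e -> irreflexive e -> Z2_planar e ->
  3 <= #|S| -> darts S e + 12 <= 6 * #|S|.
Proof.
have [m] := ubnP #|S|; elim: m S e => // m IH S e0 /ltnSE le_m es0 ei0 P0 S3.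
rewrite leqNgt; apply/negP => D0.
have S4 : 3 < #|S|.
  rewrite ltn_neqAle S3 andbT; apply: contraTneq D0 => S3'.
  by have := darts_le_sq S ei0; rewrite -S3' -leqNgt; lia.
have [|e sub [es ei /andP[lo hi]]] := @thin_darts S e0 (6 * #|S| - 12) es0 ei0.
  by lia.
have P := Z2_planar_sub sub P0.
have cardS v : v \in S -> #|S| = #|S :\ v|.+1 by move=> vS; rewrite (cardsD1 v) vS.
have noniso v : v \in S -> exists2 u, u \in S & e v u.
  move=> vS; apply/exists_inP; apply: contraTT lo => /exists_inPn iso.
  have := IH (S :\ v) e _ es ei P; rewrite -(darts_del es iso).
  by have := cardS v vS; lia.
have common u v : u \in S -> v \in S -> e u v ->
    2 < #|[set y in S | e u y & e v y]|.
  move=> uS vS euv; rewrite ltnNge; apply: contraTN lo => t2.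
  have := IH (S :\ v) _ _ (contract_sym u v es) (contract_irrefl e u v)
    (Z2_planar_contract es euv P).
  have := darts_contract es ei uS vS euv; have := cardS v vS; lia.
have [v vS dv] : exists2 v, v \in S & #|[set y in S | e v y]| <= 5.
  apply/exists_inP; apply: contraTT hi => /exists_inPn H.
  have : \sum_(x in S) 6 <= darts S e.
    by apply: leq_sum => x /H; rewrite -ltnNge.
  by rewrite sum_nat_const; lia.
have [u uS evu] := noniso v vS.
apply: (@nbhd_not_Z2_planar e v (enum [set y in S | e v y])) P => //.
- exact: enum_uniq.
- by rewrite -cardE dv andbT; apply/card_gt0P; exists u; rewrite inE uS.
- by apply/allP => x; rewrite mem_enum inE => /andP[].
move=> x; rewrite mem_enum inE => /andP[xS evx].
apply: leq_trans (common x v xS vS _) _; first by rewrite es.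
rewrite -size_filter cardE; apply: uniq_leq_size; first exact: enum_uniq.
move=> y; rewrite [_ \in enum _]mem_enum mem_filter mem_enum !inE.
by move=> /and3P[-> -> ->].
Qed.

End Z2Planar.

(** * Parity of windings *)

(** A labelling of the sides of a grid that sums to zero around every cell
    sums to zero around the boundary. *)
Lemma discrete_stokes n m (A B : nat -> nat -> bool) :
  (forall i j, i < n -> j < m ->
     A i j (+) B i.+1 j (+) A i j.+1 (+) B i j = false) ->
  \big[addb/false]_(0 <= i < n) A i 0 (+) \big[addb/false]_(0 <= i < n) A i m (+)
  \big[addb/false]_(0 <= j < m) B n j (+) \big[addb/false]_(0 <= j < m) B 0 j = false.
Proof.
elim: m => [_|m IH H]; first by rewrite addbb !big_geq.
have {}IH := IH (fun i j hi hj => H i j hi (ltnW hj)).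
have row : \big[addb/false]_(0 <= i < n) A i m (+)
    \big[addb/false]_(0 <= i < n) A i m.+1 (+) B n m (+) B 0 m = false.
  elim: n H {IH} => [_|n IHn H]; first by rewrite !big_geq //= addbb.
  have := H n m (ltnSn n) (ltnSn m).
  have := IHn (fun i j hi hj => H i j (ltnW hi) hj).
  rewrite !(big_nat_recr n) //= !addb_xorb.
  by move: (bigop _ _ _) (bigop _ _ _) (A n m) (B n.+1 m) (A n m.+1) (B n m) (B 0 m);
    do 7!case.
move: IH row; rewrite !(big_nat_recr m) //=.
by do 5!move: (bigop _ _ _); do 2!case: (B _ _); do 5!case.
Qed.

Lemma telescope_addb n (f : nat -> bool) :
  \big[addb/false]_(0 <= i < n) (f i (+) f i.+1) = f 0 (+) f n.
Proof.
elim: n => [|n IH]; first by rewrite big_geq // addbb.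
by rewrite big_nat_recr //= IH; do 3!case: (f _).
Qed.

Section Crossing.
Import Order.TTheory GRing.Theory Num.Theory.
Local Open Scope ring_scope.
Variable R : realType.
Implicit Types v w : R * R.

(** The upper half-plane with the positive half of the x-axis: every nonzero
    vector lies in exactly one of this set and its opposite, which spares any
    assumption of general position. *)
Definition upper v := (0 < v.2) || ((v.2 == 0) && (0 < v.1)).
(** For a segment that avoids the origin: whether it crosses the positive
    x-axis.  The half-planes of the ends differ, and the sign of the
    determinant tells on which side of the origin the x-axis is met. *)
Definition cross v w :=
  (upper v != upper w) && (upper w == (0 < v.1 * w.2 - v.2 * w.1)).

(** The four open half-planes bounded by the coordinate axes. *)
Definition side (k : 'I_4) v :=
  match val k with 0%N => 0 < v.1 | 1%N => v.1 < 0 | 2%N => 0 < v.2 | _ => v.2 < 0 end.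

(** Only in the right half-plane can the positive x-axis be met, and there it
    separates the vectors of [upper] from the others. *)
Lemma cross_side k v w : side k v -> side k w ->
  cross v w = (k == ord0) && (upper v (+) upper w).
Proof.
case: v w => [x y] [z t]; rewrite /cross /upper /side /=.
case: k => [[|[|[|[|//]]]] kk]; rewrite -(inj_eq val_inj) /= => x0 z0.
- rewrite x0 z0 !andbT ![_ || (_ == 0)]orbC ![_ == 0]eq_sym -!le_eqVlt.
  case: (leP 0 y) => Hy; case: (leP 0 t) => Ht //=.
    by rewrite ltNge [_ <= 0](_ : _ = true) //; nra.
  by rewrite [0 < _](_ : _ = true) //; nra.
- rewrite !(lt_gtF x0) !(lt_gtF z0) !andbF !orbF.
  case: (ltP 0 y) => Hy; case: (ltP 0 t) => Ht //=.
    by rewrite [0 < _](_ : _ = true) //; nra.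
  by rewrite ltNge [_ <= 0](_ : _ = true) //; nra.
- by rewrite x0 z0.
- by rewrite !(lt_gtF x0) !(lt_gtF z0) !(lt_eqF x0) !(lt_eqF z0).
Qed.

Lemma cross_cell k v1 v2 v3 v4 :
  side k v1 -> side k v2 -> side k v3 -> side k v4 ->
  cross v1 v2 (+) cross v2 v3 (+) cross v4 v3 (+) cross v1 v4 = false.
Proof.
move=> s1 s2 s3 s4; rewrite !(@cross_side k) //.
by case: (k == _) => //=; do 4!case: (upper _).
Qed.

Lemma upperN v : v != 0 -> upper (- v) = ~~ upper v.
Proof.
case: v => x y; rewrite /upper -[0]/((0, 0) : R * R) xpair_eqE /= !oppr_gt0 oppr_eq0.
by case: (ltgtP 0 y) => //= _; rewrite andbT; case: ltgtP.
Qed.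

(** The opposite segment crosses the positive x-axis when the segment crosses
    the negative one; the two crossings add up to the change of
    half-plane. *)
Lemma crossN v w : v != 0 -> w != 0 ->
  cross (- v) (- w) = cross v w (+) (upper v (+) upper w).
Proof.
move=> v0 w0; rewrite /cross !upperN //= !mulrNN.
by case: (upper v) (upper w) (_ < _) => [] [] [].
Qed.

Definition winding (n : nat) (g : nat -> R * R) p :=
  \big[addb/false]_(0 <= i < n) cross (g i - p) (g i.+1 - p).

(** On the boundary of the grid of differences [a i - b j], the sides where
    [i] varies are windings of [a] around the ends of [b].  Where [j] varies
    the vectors are opposite to those of the winding of [b], and [crossN]
    turns them around at the cost of the terms [upper]. *)
Lemma winding_relation n (a b : nat -> R * R) :
  (forall i j, (i <= n)%N -> (j <= n)%N -> a i != b j) ->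
  (forall i j, (i < n)%N -> (j < n)%N -> exists k,
     [/\ side k (a i - b j), side k (a i.+1 - b j), side k (a i.+1 - b j.+1) &
         side k (a i - b j.+1)]) ->
  winding n a (b 0%N) (+) winding n a (b n) (+)
    winding n b (a 0%N) (+) winding n b (a n) =
  upper (b 0%N - a 0%N) (+) upper (b n - a 0%N) (+)
    upper (b 0%N - a n) (+) upper (b n - a n).
Proof.
move=> nab cell.
pose F i j := a i - b j.
have := @discrete_stokes n n (fun i j => cross (F i j) (F i.+1 j))
  (fun i j => cross (F i j) (F i j.+1)).
have wb i : (i <= n)%N -> \big[addb/false]_(0 <= j < n) cross (F i j) (F i j.+1) =
    winding n b (a i) (+) (upper (b 0%N - a i) (+) upper (b n - a i)).
  move=> le_i; rewrite -(telescope_addb n (fun j => upper (b j - a i))).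
  rewrite /winding -big_split; apply: eq_big_nat => j /andP[_ lt_j].
  rewrite /= -crossN ?subr_eq0 1?eq_sym ?nab //; last exact: ltnW.
  by rewrite /F !opprB.
rewrite !wb // -/(winding n a (b 0%N)) -/(winding n a (b n)) => H.
have {}H := H (fun i j li lj => let: ex_intro k (And4 s1 s2 s3 s4) := cell i j li lj in
  cross_cell s1 s2 s3 s4).
by rewrite -[LHS]addbF -H !addb_xorb; btauto.
Qed.

End Crossing.

(** * Sampling of disjoint arcs *)

Section Grid.
Import Order.TTheory GRing.Theory Num.Theory numFieldNormedType.Exports.
Local Open Scope ring_scope.
Local Open Scope classical_set_scope.
Variable R : realType.

Definition separated (f g : R -> R) (n : nat) (x : R * R) :=
  forall s t, s \in `[0, 1]%R -> t \in `[0, 1]%R ->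
    `|s - x.1| <= n.+1%:R^-1 -> `|t - x.2| <= n.+1%:R^-1 -> f s < g t.

(** Jointly near [x] and for large [n]: the form in which compactness of the
    square makes the threshold on [n] uniform. *)
Lemma near_separated (f g : R -> R) (x : R * R) :
  {within `[0, 1], continuous f} -> {within `[0, 1], continuous g} ->
  x.1 \in `[0, 1]%R -> x.2 \in `[0, 1]%R -> f x.1 < g x.2 ->
  \forall y \near x & n \near \oo, separated f g n y.
Proof.
move=> /subspace_continuousP cf /subspace_continuousP cg x1 x2 ltfg.
pose c := (f x.1 + g x.2) / 2.
have fc : f x.1 < c by rewrite /c; lra.
have cg' : c < g x.2 by rewrite /c; lra.
have /nbhs_ballP[d d0 Hd] : \forall s \near x.1, `[0, 1]%classic s -> f s < c.
  have /(_ (within_filter _ _)) := cvgr_lt (f x.1) (cf _ x1) _ fc.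
  by rewrite near_withinE.
have /nbhs_ballP[e e0 He] : \forall t \near x.2, `[0, 1]%classic t -> c < g t.
  have /(_ (within_filter _ _)) := cvgr_gt (g x.2) (cg _ x2) _ cg'.
  by rewrite near_withinE.
pose r := Num.min d e.
have r0 : 0 < r / 2 by rewrite divr_gt0 // lt_min d0.
near=> y n => s t s01 t01 sy ty.
have nr : n.+1%:R^-1 < r / 2 by near: n; exact: (near_infty_natSinv_lt (PosNum r0)).
have [y1 y2] : ball x (r / 2) y by near: y; exact: nbhsx_ballx.
have [rd re] : r <= d /\ r <= e by rewrite !ge_min !lexx orbT.
have tri (p q u : R) : `|p - q| <= n.+1%:R^-1 -> ball u (r / 2) q -> `|u - p| < r.
  move=> pq uq; rewrite (le_lt_trans (ler_distD q u p)) //.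
  rewrite [ltRHS]splitr; apply: ltrD; first exact: uq.
  by rewrite distrC (le_lt_trans pq).
apply: (@lt_trans _ _ c).
  by apply: Hd => //; exact: lt_le_trans (tri _ _ _ sy y1) rd.
by apply: He => //; exact: lt_le_trans (tri _ _ _ ty y2) re.
Unshelve. all: by end_near.
Qed.

(** The samples of [a] at the multiples of [1 / (n + 1)]. *)
Definition grid (n : nat) (a : R -> R * R) (i : nat) := a (i%:R / n.+1%:R).

(** At each point of the square the two arcs differ in some coordinate, hence
    [a s - b t] stays in one of the half-planes of [side] around that point;
    compactness gives a mesh for which this holds on every cell. *)
Lemma grid_side (a b : R -> R * R) :
  {within `[0, 1], continuous a} -> {within `[0, 1], continuous b} ->
  (forall s t, s \in `[0, 1]%R -> t \in `[0, 1]%R -> a s <> b t) ->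
  \forall n \near \oo, forall i j, (i < n.+1)%N -> (j < n.+1)%N -> exists k,
    [/\ side k (grid n a i - grid n b j), side k (grid n a i.+1 - grid n b j),
        side k (grid n a i.+1 - grid n b j.+1) &
        side k (grid n a i - grid n b j.+1)].
Proof.
move=> ca cb nab.
have cpr (p : R * R -> R) (c : R -> R * R) : continuous p ->
    {within `[0, 1], continuous c} -> {within `[0, 1], continuous (p \o c)}.
  move=> cp /subspace_continuousP cc; apply/subspace_continuousP => s s01.
  by apply: cvg_comp; [exact: cc|exact: cp].
have cfst : continuous (fst : R * R -> R) by move=> x; exact: cvg_fst.
have csnd : continuous (snd : R * R -> R) by move=> x; exact: cvg_snd.
have ca1 : {within `[0, 1], continuous (fst \o a)} by exact: cpr.
have cb1 : {within `[0, 1], continuous (fst \o b)} by exact: cpr.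
have ca2 : {within `[0, 1], continuous (snd \o a)} by exact: cpr.
have cb2 : {within `[0, 1], continuous (snd \o b)} by exact: cpr.
have cN (f : R -> R) : {within `[0, 1], continuous f} ->
    {within `[0, 1], continuous (fun s => - f s)}.
  move=> /subspace_continuousP cf; apply/subspace_continuousP => s s01.
  by apply: cvgN; exact: cf.
pose sep (n : nat) (x : R * R) := exists k : 'I_4, forall s t,
  s \in `[0, 1]%R -> t \in `[0, 1]%R -> `|s - x.1| <= n.+1%:R^-1 ->
  `|t - x.2| <= n.+1%:R^-1 -> side k (a s - b t).
have sepI k (f g : R -> R) : {within `[0, 1], continuous f} ->
    {within `[0, 1], continuous g} -> (forall s t, side k (a s - b t) = (f s < g t)) ->
    forall x, x.1 \in `[0, 1]%R -> x.2 \in `[0, 1]%R -> f x.1 < g x.2 ->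
    \forall y \near x & n \near \oo, sep n y.
  move=> cf cg fg x x1 x2 lt_fg.
  have := near_separated cf cg x1 x2 lt_fg.
  apply: filterS => -[y n] /= H; exists k => s t s01 t01 sx tx.
  by rewrite fg H.
have sep0 := @sepI (Ordinal (isT : (0 < 4)%N)) _ _ (cN _ ca1) (cN _ cb1).
have sep1 := @sepI (Ordinal (isT : (1 < 4)%N)) _ _ ca1 cb1.
have sep2 := @sepI (Ordinal (isT : (2 < 4)%N)) _ _ (cN _ ca2) (cN _ cb2).
have sep3 := @sepI (Ordinal (isT : (3 < 4)%N)) _ _ ca2 cb2.
have /compact_near_coveringP cover :
    compact ([set` `[0, 1]%R] `*` [set` `[0, 1]%R] : set (R * R)).
  by apply: compact_setX; apply: segment_compact.
have {}cover : \forall n \near \oo, [set` `[0, 1]%R] `*` [set` `[0, 1]%R] `<=` sep n.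
  apply: cover => x [/= x1 x2].
  have [lt0|lt0|eq0] := ltgtP (a x.1).1 (b x.2).1.
  - by apply: sep1 => // s t; rewrite /side /= subr_lt0.
  - by apply: sep0; rewrite //= ?ltrN2 // => s t; rewrite /side /= ltrN2 subr_gt0.
  have [lt1|lt1|eq1] := ltgtP (a x.1).2 (b x.2).2.
  - by apply: sep3 => // s t; rewrite /side /= subr_lt0.
  - by apply: sep2; rewrite //= ?ltrN2 // => s t; rewrite /side /= ltrN2 subr_gt0.
  by case: (nab _ _ x1 x2); move: eq0 eq1; case: (a _) (b _) => ? ? [? ?] /= -> ->.
apply: filterS cover => n cov i j lt_i lt_j.
have unit (l : nat) : (l <= n.+1)%N -> (l%:R / n.+1%:R : R) \in `[0, 1]%R.
  by move=> le_l; rewrite in_itv /= divr_ge0 //= ler_pdivrMr ?mul1r ?ler_nat ?ltr0n.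
have near0 l : `|l%:R / n.+1%:R - l%:R / n.+1%:R : R| <= n.+1%:R^-1.
  by rewrite subrr normr0 invr_ge0.
have nearS l : `|l.+1%:R / n.+1%:R - l%:R / n.+1%:R : R| <= n.+1%:R^-1.
  by rewrite -mulrBl -natrB // subSnn mul1r ger0_norm // invr_ge0.
have [|k Hk] := cov (i%:R / n.+1%:R, j%:R / n.+1%:R).
  by split; apply: unit; exact: ltnW.
by exists k; split; apply: Hk => //; apply: unit => //; exact: ltnW.
Qed.

Lemma grid0 n a : grid n a 0 = a 0.
Proof. by rewrite /grid mul0r. Qed.

Lemma grid_last n a : grid n a n.+1 = a 1.
Proof. by rewrite /grid divff // pnatr_eq0. Qed.

Lemma near_winding_relation (a b : R -> R * R) :
  {within `[0, 1], continuous a} -> {within `[0, 1], continuous b} ->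
  (forall s t, s \in `[0, 1]%R -> t \in `[0, 1]%R -> a s <> b t) ->
  \forall n \near \oo,
    winding n.+1 (grid n a) (b 0) (+) winding n.+1 (grid n a) (b 1) (+)
    winding n.+1 (grid n b) (a 0) (+) winding n.+1 (grid n b) (a 1) =
    upper (b 0 - a 0) (+) upper (b 1 - a 0) (+)
      upper (b 0 - a 1) (+) upper (b 1 - a 1).
Proof.
move=> ca cb nab; apply: filterS (grid_side ca cb nab) => n side_n.
have := @winding_relation R n.+1 (grid n a) (grid n b) _ side_n.
rewrite !grid0 !grid_last; apply => i j le_i le_j; apply/eqP/nab.
  by rewrite in_itv /= divr_ge0 //= ler_pdivrMr ?mul1r ?ler_nat ?ltr0n.
by rewrite in_itv /= divr_ge0 //= ler_pdivrMr ?mul1r ?ler_nat ?ltr0n.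
Qed.
End Grid.

(** * Drawings satisfy the parity relations *)

Section PlanarZ2.
Import Order.TTheory GRing.Theory Num.Theory numFieldNormedType.Exports.
Local Open Scope ring_scope.
Variables (R : realType) (G : sgraph).

Lemma arc_ends (pos : G -> R * R) (arc : {set G} -> R -> R * R) (x y : G) :
  plane_drawing pos arc -> adj x y ->
  (arc [set x; y]%SET 0 = pos x /\ arc [set x; y]%SET 1 = pos y) \/
  (arc [set x; y]%SET 0 = pos y /\ arc [set x; y]%SET 1 = pos x).
Proof.
move=> D xy; have xyE : [set x; y]%SET \in edges G by rewrite mem_edges.
have Dxy := drawing_ends D xyE.
have neq : arc [set x; y]%SET 0 <> arc [set x; y]%SET 1.
  move=> /(drawing_arc_inj D xyE); rewrite !in_itv /= !lexx ler01.
  by move=> /(_ isT isT)/eqP; rewrite eq_sym oner_eq0.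
have ends t : t = 0 \/ t = 1 -> arc [set x; y]%SET t = pos x \/
      arc [set x; y]%SET t = pos y.
  move=> t01; have : (pos @` [set` [set x; y]%SET])%classic (arc [set x; y]%SET t).
    by rewrite -Dxy; case: t01 => ->; [left|right].
  by case=> z /=; rewrite !inE => /orP[] /eqP -> <-; [left|right].
have [e0|e0] := ends 0 (or_introl erefl); have [e1|e1] := ends 1 (or_intror erefl);
  by [left|right|case: neq; rewrite e0 e1].
Qed.

Lemma arcs_disjoint (pos : G -> R * R) (arc : {set G} -> R -> R * R)
    (i j k l : G) s t : plane_drawing pos arc ->
  uniq [:: i; j; k; l] -> adj i j -> adj k l ->
  s \in `[0, 1] -> t \in `[0, 1] -> arc [set i; j]%SET s <> arc [set k; l]%SET t.
Proof.
move=> D U ij kl.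
have ijE : [set i; j]%SET \in edges G by rewrite mem_edges.
have klE : [set k; l]%SET \in edges G by rewrite mem_edges.
have npos x y : x \in [:: i; j] -> y \in [:: k; l] -> pos x <> pos y.
  move=> xij ykl /(drawing_pos_inj D) xy; move: U.
  rewrite -[[:: i; j; k; l]]/([:: i; j] ++ [:: k; l]) cat_uniq => /and3P[_ /hasP[]].
  by exists y; rewrite //= -xy.
have nE : [set i; j]%SET != [set k; l]%SET.
  move: U; rewrite /= !inE !negb_or => /and4P[/and3P[_ ik il] _ _ _].
  by apply/eqP => /setP/(_ i); rewrite !inE eqxx (negPf ik) (negPf il).
have itvE (u : R) : u \in `[0, 1] -> [\/ u = 0, u = 1 | u \in `]0, 1[].
  rewrite !in_itv /= !le_eqVlt => /andP[/orP[/eqP<-|u0]]; first by constructor.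
  by case/orP => [/eqP->|u1]; [constructor 2|constructor 3; rewrite u0].
move=> /itvE s01 /itvE t01.
have epos (x y : G) u : adj x y -> u = 0 \/ u = 1 ->
    exists2 z, z \in [:: x; y] & arc [set x; y]%SET u = pos z.
  by move=> xy [] ->; case: (arc_ends D xy) => [] [E0 E1];
    (exists x; [by rewrite !inE eqxx|by []]) ||
    (exists y; [by rewrite !inE eqxx orbT|by []]).
case: s01 => [s0|s1|sI]; case: t01 => [t0|t1|tI];
  try (have [|x xI Ex] := epos i j s ij; first by [left|right]);
  try (have [|y yI Ey] := epos k l t kl; first by [left|right]);
  rewrite ?Ex ?Ey.
all: try by apply: npos.
all: try exact: (drawing_avoids_vertices D).
all: try by move/esym; exact: (drawing_avoids_vertices D).
exact: (drawing_no_crossing D).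
Qed.

Lemma planar_Z2_planar : planar R G -> Z2_planar (@adj G).
Proof.
move=> [pos [arc D]].
pose w n x y z := winding n.+1 (grid n (arc [set x; y]%SET)) (pos z).
pose h x y := upper (pos y - pos x).
pose rel4 n (q : G * G * (G * G)) := let: (i, j, (k, l)) := q in
  uniq [:: i; j; k; l] -> adj i j -> adj k l ->
  w n i j k (+) w n i j l (+) w n k l i (+) w n k l j =
  h i k (+) h i l (+) h j k (+) h j l.
(* One mesh must serve all pairs of edges, since [w] may not depend on the
   pair. *)
have /filter_ex[n Hn] : (\forall n \near \oo, forall q, rel4 n q)%classic.
  apply: filter_forall => -[[i j] [k l]] /=.
  have [U|nU] := boolP (uniq [:: i; j; k; l]); last first.
    by apply: nearW => n U; case/negP: nU.
  have [ij|nij] := boolP (adj i j); last first.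
    by apply: nearW => n _ ij; case/negP: nij.
  have [kl|nkl] := boolP (adj k l); last first.
    by apply: nearW => n _ _ kl; case/negP: nkl.
  have ijE : [set i; j]%SET \in edges G by rewrite mem_edges.
  have klE : [set k; l]%SET \in edges G by rewrite mem_edges.
  have := near_winding_relation (drawing_continuous D ijE)
    (drawing_continuous D klE) (fun s t => arcs_disjoint D U ij kl).
  apply: filterS => n H _ _ _; move: H; rewrite /w /h.
  by case: (arc_ends D ij) => [] [-> ->]; case: (arc_ends D kl) => [] [-> ->];
    do 4!case: (winding _ _ _); do 4!case: (upper _).
exists h, (w n); split=> [x y nxy|i j k l]; last exact: (Hn (i, j, (k, l))).
rewrite /h -upperN ?opprB // subr_eq0.
by apply: contraNneq nxy => /(drawing_pos_inj D) ->.
Qed.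
End PlanarZ2.

(** * Components and cut-edges *)

Section Components.
Local Open Scope set_scope.

Section Classes.
Variable V : finType.
Implicit Types r : rel V.

Lemma classE r x : [set y in [set: V] | r x y] = [set y | r x y].
Proof. by apply/setP => y; rewrite !inE. Qed.

Lemma eq_equivalence_partition r r' : r =2 r' ->
  equivalence_partition r [set: V] = equivalence_partition r' [set: V].
Proof.
move=> rr'; apply: eq_imset => x; rewrite !classE.
by apply/setP => y; rewrite !inE rr'.
Qed.

Lemma eq_class r x y : equivalence_rel r -> r x y -> [set z | r x z] = [set z | r y z].
Proof. by move=> er xy; apply/setP => z; rewrite !inE (er x y z).2. Qed.

(** The relation [r'] merges the class of [y] into that of [x] and leaves the
    other classes alone.  So [g], which sends a class of [r] to the class of
    [r'] that contains it, is a bijection once the class of [y] is left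
    out. *)
Lemma card_merge_classes r r' x y : equivalence_rel r -> equivalence_rel r' ->
  (forall a b, r' a b = [|| r a b, r a x && r y b | r a y && r x b]) ->
  #|equivalence_partition r [set: V]| =
  #|equivalence_partition r' [set: V]| + ~~ r x y.
Proof.
move=> er er' r'E.
have rxx z : r z z := (er z z z).1.
have rC a b : r a b = r b a.
  by apply/idP/idP => ab; [rewrite -(er a b a).2|rewrite -(er b a b).2].
have rT a b c : r a b -> r b c = r a c by move=> /(er a b c).2 ->.
have [rxy|nrxy] := boolP (r x y).
  rewrite addn0 (@eq_equivalence_partition r r') // => a b.
  rewrite r'E; case: (boolP (r a b)) => //= nab; apply/esym/negbTE.
  apply: contraNN nab => /orP[] /andP[a1 b1].
    by rewrite -(rT a x b) // -(rT x y b).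
  by rewrite -(rT a y b) // (rT x y b).
pose cl := fun z => [set b | r z b].
pose g (X : {set V}) := \bigcup_(a in X) [set b | r' a b].
have gE a : g (cl a) = [set b | r' a b].
  apply/setP => b; apply/bigcupP/idP => [[c]|]; last first.
    by rewrite inE => ab; exists a; rewrite inE ?rxx.
  by rewrite !inE => ac; rewrite (er' a c b).2 // r'E ac.
have -> : equivalence_partition r' [set: V] =
    g @: (equivalence_partition r [set: V] :\ cl y).
  apply/setP => X; apply/imsetP/imsetP => [[a _ ->]|[Y]].
    have [ay|nay] := boolP (r a y).
      exists (cl x); first rewrite !inE; last first.
        rewrite gE classE; apply: eq_class => //.
        by rewrite r'E ay rxx !orbT.
      apply/andP; split; last by apply/imsetP; exists x; rewrite ?inE ?classE.
      by apply: contraNneq nrxy => /setP/(_ y); rewrite !inE rxx.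
    exists (cl a); last by rewrite gE classE.
    rewrite !inE; apply/andP; split.
      by apply: contraNneq nay => /setP/(_ y); rewrite !inE rxx.
    by apply/imsetP; exists a; rewrite ?inE ?classE.
  rewrite !inE => /andP[_ /imsetP[a _ ->]] ->.
  by exists a; rewrite // !classE gE.
rewrite card_in_imset; first last.
  move=> X Y; rewrite !inE => /andP[nX /imsetP[a _ Xa]] /andP[nY /imsetP[b _ Yb]].
  move: nX nY; rewrite {X}Xa {Y}Yb !classE -!/(cl _) !gE => na nb /setP/(_ b).
  rewrite !inE [r' b b](er' b b b).1 r'E => /or3P[ab|/andP[_ yb]|/andP[ay _]].
  - exact: eq_class.
  - by case/eqP: nb; apply: eq_class; rewrite // rC.
  - by case/eqP: na; apply: eq_class.
rewrite [LHS](cardsD1 (cl y)) addnC; congr (_ + _).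
by case: imsetP => // -[]; exists y; rewrite ?classE.
Qed.

End Classes.

Section Rel.
Variable V : finType.
Implicit Types e : rel V.

Lemma connect_equiv e : symmetric e -> equivalence_rel (connect e).
Proof.
move=> es; have sc := sym_connect_sym es.
by move=> x y z; split=> [|xy]; [exact: connect0|exact: same_connect].
Qed.

Lemma connect_step e x y : connect e x y -> x != y -> exists z, e x z.
Proof.
case/connectP => -[|z p] /=; first by move=> _ ->; rewrite eqxx.
by case/andP => xz _ _ _; exists z.
Qed.

Lemma connect_del1 e e' x y : symmetric e -> e x y ->
  (forall a b, e' a b = e a b && ([set a; b] != [set x; y])) ->
  forall a b, connect e a b = [|| connect e' a b, connect e' a x && connect e' y b |
    connect e' a y && connect e' x b].
Proof.
move=> es exy e'E a b; apply/idP/idP; last first.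
  have sub : subrel (connect e') (connect e).
    by apply: connect_sub => c d; rewrite e'E => /andP[/connect1].
  have eyx : e y x by rewrite es.
  case/or3P => [/sub //|/andP[/sub ax /sub yb]|/andP[/sub ay /sub xb]].
    exact: connect_trans ax (connect_trans (connect1 exy) yb).
  exact: connect_trans ay (connect_trans (connect1 eyx) xb).
case/connectP => p; elim: p a => [a _ -> |c p IH a /=]; first by rewrite connect0.
case/andP => eac pc lb; have {IH} := IH c pc lb.
have [/eqP E|ne] := boolP ([set a; c] == [set x; y]).
  move: E => /eqP; rewrite eq_set2 => /orP[] /andP[/eqP-> /eqP->].
    case/or3P => [yb|/andP[_ yb]|/andP[_ xb]].
    - by rewrite connect0 yb orbT.
    - by rewrite connect0 yb orbT.
    - by rewrite xb.
  case/or3P => [xb|/andP[_ yb]|/andP[_ xb]].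
  - by rewrite connect0 xb !orbT.
  - by rewrite yb.
  - by rewrite connect0 xb !orbT.
have /connect1 ac : e' a c by rewrite e'E eac.
by case/or3P => [cb|/andP[cx yb]|/andP[cy xb]]; apply/or3P;
  [constructor 1|constructor 2|constructor 3]; rewrite ?yb ?xb ?andbT;
  apply: connect_trans ac _.
Qed.
End Rel.
End Components.

Section Bridges.
Local Open Scope set_scope.
Implicit Types G : sgraph.

Lemma edges_del G (F : {set {set G}}) : edges (del_edges F) = edges G :\: F.
Proof.
apply/setP => f; rewrite inE; apply/(@edgesP (del_edges F))/andP.
  by case=> x [y [/andP[xy nF] ->]]; rewrite mem_edges.
by case=> nF /edgesP[x [y [xy fE]]]; exists x, y; rewrite /= /del_adj xy -fE.
Qed.

Lemma connected_graphP G :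
  connected_graph G <-> (exists x : G, True) /\ forall x y : G, connect adj x y.
Proof.
have er := connect_equiv (@adj_sym G).
rewrite /connected_graph /components; split.
  move=> c1.
  have cE (x : G) : [set y | connect adj x y] \in
      equivalence_partition (connect (@adj G)) [set: G].
    by apply/imsetP; exists x; rewrite ?classE.
  have /cards1P[C CE] : #|equivalence_partition (connect (@adj G)) [set: G]| == 1.
    exact/eqP.
  split=> [|x y].
    have : C \in equivalence_partition (connect (@adj G)) [set: G] by rewrite CE inE.
    by case/imsetP => x _ _; exists x.
  have := cE x; have := cE y; rewrite CE !inE => /eqP <- /eqP/setP/(_ y).
  by rewrite !inE connect0.
case=> [[x0 _] con].
rewrite (_ : equivalence_partition _ _ = [set [set: G]]) ?cards1 //.
apply/setP => X; rewrite inE; apply/imsetP/eqP => [[x _ ->]|->].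
  by apply/setP => y; rewrite !inE con.
by exists x0; rewrite // classE; apply/setP => y; rewrite !inE con.
Qed.

Lemma card_components_del1 G (x y : G) : adj x y ->
  #|components (del_edges [set [set x; y]])| =
  #|components G| + ~~ connect (del_adj [set [set x; y]]) x y.
Proof.
move=> xy; apply: card_merge_classes.
- exact: connect_equiv (@adj_sym (del_edges [set [set x; y]])).
- exact: connect_equiv (@adj_sym G).
by apply: connect_del1 xy _ => [|a b]; [exact: adj_sym|rewrite /= /del_adj inE].
Qed.

Lemma cut_edgesP G (x y : G) : adj x y ->
  ([set x; y] \in cut_edges G) = ~~ connect (del_adj [set [set x; y]]) x y.
Proof.
move=> xy; rewrite inE mem_edges xy card_components_del1 // -[ltnLHS]addn0 ltn_add2l.
by case: connect.
Qed.

Lemma card_components_del2 G (F : {set {set G}}) (x y : G) : adj x y ->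
    [set x; y] \notin F ->
  #|components (del_edges ([set x; y] |: F))| =
  #|components (del_edges F)| + ~~ connect (del_adj ([set x; y] |: F)) x y.
Proof.
move=> xy nF; have xy' : @adj (del_edges F) x y by rewrite /= /del_adj xy.
have dE : @del_adj (del_edges F) [set [set x; y]] =2 @del_adj G ([set x; y] |: F).
  move=> a b; rewrite /del_adj /= /del_adj in_setU1 negb_or inE -andbA.
  by congr andb; rewrite andbC.
have := card_components_del1 xy'; rewrite (eq_connect dE) => <-.
by rewrite /components; congr #|pred_of_set _|; apply: eq_equivalence_partition;
  apply: eq_connect => a b; rewrite [RHS]dE.
Qed.

(** A cut-edge still separates its ends after other edges are deleted, so each
    deleted cut-edge adds one component. *)
Lemma card_components_del_cut G (F : {set {set G}}) : F \subset cut_edges G ->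
  #|components (del_edges F)| = #|components G| + #|F|.
Proof.
have [m] := ubnP #|F|; elim: m F => // m IH F /ltnSE le_m sF.
have [->|[f fF]] := set_0Vmem F.
  rewrite cards0 addn0 /components; congr #|pred_of_set _|.
  apply: eq_equivalence_partition; apply: eq_connect => a b.
  by rewrite /= /del_adj inE andbT.
have fcut := subsetP sF f fF.
have := fcut; rewrite inE => /andP[/edgesP[x [y [xy fE]]] _].
have FE : F = f |: (F :\ f) by rewrite setD1K.
have nf : f \notin F :\ f by rewrite !inE eqxx.
have cF : #|F| = (#|F :\ f|).+1 by rewrite (cardsD1 f) fF.
have IHf : #|components (del_edges (F :\ f))| = #|components G| + #|F :\ f|.
  by apply: IH; [rewrite -cF|exact: subset_trans (subD1set _ _) sF].
have nxy : [set x; y] \notin F :\ f by rewrite -fE.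
have := card_components_del2 xy nxy; rewrite -fE -FE IHf => ->.
rewrite cF addnS -addn1; congr (_ + _).
move: fcut; rewrite {1}fE cut_edgesP // => ncon; apply/eqP; rewrite eqb1.
apply: contraNN ncon; apply: connect_sub => a b /andP[ab nab].
apply: connect1; rewrite /del_adj ab /=; apply: contraNN nab.
by rewrite inE -fE => /eqP->.
Qed.

(** Deleting [x y] and all cut-edges yields as many components as deleting the
    cut-edges alone, because the cut-edges of the graph are cut-edges of the
    graph without [x y]. *)
Lemma connect_del_noncut G (x y : G) : adj x y -> [set x; y] \notin cut_edges G ->
  connect (del_adj ([set x; y] |: cut_edges G)) x y.
Proof.
move=> xy ncut; set f := [set x; y] in ncut *.
pose G1 := del_edges [set f].
have c1 : #|components G1| = #|components G|.
  by rewrite card_components_del1 // -cut_edgesP // (negPf ncut) addn0.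
have sub : cut_edges G \subset cut_edges G1.
  apply/subsetP => b bcut; have := bcut; rewrite inE => /andP[/edgesP[u [v [uv bE]]] _].
  have bf : b != f by apply: contraNneq ncut => <-.
  have uv1 : @adj G1 u v by rewrite /= /del_adj uv inE -bE.
  rewrite bE (cut_edgesP uv1); move: bcut; rewrite bE cut_edgesP //; apply: contraNN.
  apply: connect_sub => p q; rewrite /del_adj /= /del_adj => /andP[/andP[pq _] npq].
  by apply: connect1; rewrite pq.
have := @card_components_del_cut G1 (cut_edges G) sub.
rewrite c1 -(card_components_del_cut (subxx _)).
have := card_components_del2 xy ncut; rewrite -/f.
have -> : #|components (del_edges (f |: cut_edges G))| =
          #|components (@del_edges G1 (cut_edges G))|.
  rewrite /components; congr #|pred_of_set _|; apply: eq_equivalence_partition.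
  apply: eq_connect => a b; rewrite /= /del_adj /= /del_adj.
  by rewrite in_setU1 in_set1 negb_or andbA.
by move=> -> /eqP; rewrite -[X in _ == X]addn0 eqn_add2l eqb0 negbK.
Qed.
End Bridges.

(** * Edge counts, subgraphs and cycles *)

Section Counting.
Local Open Scope set_scope.
Implicit Types G : sgraph.

Lemma dartsE (V : finType) (S : {set V}) (e : rel V) :
  darts S e = #|[set p : V * V | [&& p.1 \in S, p.2 \in S & e p.1 p.2]]|.
Proof.
rewrite /darts -sum1_card.
under eq_bigr do rewrite -sum1_card.
rewrite pair_big_dep /=; apply: eq_bigl => -[x y]; by rewrite !inE.
Qed.

Lemma card_edges G : 2 * #|edges G| = darts [set: G] (@adj G).
Proof.
pose h (p : G * G) := [set p.1; p.2].
rewrite dartsE -[RHS]sum1_card (partition_big_imset h) /=.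
rewrite (_ : [set h x | x in _] = edges G); last first.
  by apply/setP => f; apply/imsetP/imsetP => -[p Hp ->]; exists p => //;
    move: Hp; rewrite !inE.
rewrite mulnC -sum_nat_const; apply: eq_bigr => f /edgesP[x [y [xy ->]]].
rewrite sum1_card.
have nxy : (x, y) != (y, x).
  by rewrite xpair_eqE; apply: contraTN xy => /andP[/eqP-> _]; rewrite adj_irrefl.
transitivity #|[set (x, y); (y, x)]|; first by rewrite cards2 nxy.
apply: eq_card => -[a b]; rewrite !inE /= unfold_in /= !inE /= eq_set2 !xpair_eqE.
by apply/idP/andP => [/orP[] /andP[/eqP-> /eqP->]|[]//];
  rewrite !eqxx ?orbT; split; rewrite // adj_sym.
Qed.

Lemma planar_hom R (G1 G2 : sgraph) (f : G1 -> G2) : injective f ->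
  (forall x y, adj x y -> adj (f x) (f y)) -> planar R G2 -> planar R G1.
Proof.
move=> fi fh [pos [arc D]]; exists (pos \o f), (fun e : {set G1} => arc (f @: e)).
have fE (e : {set G1}) : e \in edges G1 -> f @: e \in edges G2.
  by case/edgesP => x [y [xy ->]]; rewrite imsetU1 imset_set1 mem_edges fh.
split.
- by move=> x y /(drawing_pos_inj D) /fi.
- by move=> e /fE; exact: (drawing_continuous D).
- by move=> e /fE; exact: (drawing_arc_inj D).
- move=> e /[dup] eE /fE /(drawing_ends D) ->.
  apply/seteqP; split=> [_ [_ /imsetP[x xe ->] <-]|_ [x xe <-]]; first by exists x.
  by exists (f x) => //=; apply: imset_f.
- by move=> e t v /fE eE tI; exact: (drawing_avoids_vertices D).
move=> e e' s t /fE eE /fE eE' nee' sI tI; apply: (drawing_no_crossing D) => //.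
by rewrite (inj_eq (imset_inj fi)).
Qed.

Lemma planar_edges R G : planar R G -> 3 <= #|G| -> #|edges G| + 6 <= 3 * #|G|.
Proof.
move=> /planar_Z2_planar P G3.
have := @darts_Z2_planar _ _ [set: G] (@adj_sym G) (@adj_irrefl G) P.
by rewrite cardsT -card_edges => /(_ G3); lia.
Qed.

Lemma card_induced G (S : {set G}) : #|induced_subgraph S| = #|S|.
Proof. by rewrite /= card_sig; apply: eq_card => x; rewrite inE. Qed.

Lemma card_edges_induced G (S : {set G}) :
  2 * #|edges (induced_subgraph S)| = darts S (@adj G).
Proof.
rewrite card_edges !dartsE.
pose f (p : induced_subgraph S * induced_subgraph S) := (val p.1, val p.2) : G * G.
have fi : injective f by move=> [a b] [c d] [/val_inj -> /val_inj ->].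
rewrite -(card_imset _ fi); apply: eq_card => -[x y]; rewrite inE /=.
apply/imsetP/and3P => [[[a b]]|[xS yS xy]].
  by rewrite !inE /= => ab [-> ->]; split=> //; exact: valP.
by exists (exist _ x xS, exist _ y yS); rewrite ?inE.
Qed.

Lemma connected_induced_component G (C : {set G}) : C \in components G ->
  connected_graph (induced_subgraph C).
Proof.
case/imsetP => x _; rewrite classE => CE.
have xC : x \in C by rewrite CE inE.
have sym := sym_connect_sym (@adj_sym G).
apply/connected_graphP; split; first by exists (exist _ x xC).
move=> [a aC] [b bC]; have : connect adj a b.
  by move: (aC) (bC); rewrite {1 2}CE !inE sym; exact: connect_trans.
case/connectP => p; elim: p a aC => [a aC _ /= ba|c p IH a aC /= /andP[ac pc] lb].
  by rewrite (_ : exist _ a _ = exist _ b bC) //; exact: val_inj.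
have cC : c \in C.
  by move: (aC); rewrite CE !inE => xa; exact: connect_trans xa (connect1 ac).
by apply: connect_trans (IH c cC pc lb); apply: connect1.
Qed.

(** The rest of a cycle joins the ends of its first edge without using that
    edge. *)
Lemma acyclic_cut_edges G : edges G \subset cut_edges G -> acyclic G.
Proof.
move=> sub [|x [|y [|z s]]] //= _ /andP[/and3P[xy yz pz] U].
have xy' : adj x y := xy.
have := subsetP sub _ (etrans (mem_edges x y) xy).
rewrite cut_edgesP // => /negP; apply.
rewrite (sym_connect_sym (@adj_sym (del_edges [set [set x; y]]))).
move: U; rewrite /= !inE !negb_or.
move=> /and4P[/and3P[nxy nxz xs] /andP[nyz ys] zs _].
have keep (a b : G) : adj a b -> a \notin [:: x; y] ->
    connect (del_adj [set [set x; y]]) a b.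
  rewrite !inE negb_or => ab /andP[ax ay]; apply: connect1.
  by rewrite /del_adj ab inE eq_set2 (negPf ax) (negPf ay).
apply: connect_trans (_ : connect _ z x).
  rewrite (sym_connect_sym (@adj_sym (del_edges [set [set x; y]]))).
  by apply: keep; [rewrite adj_sym|rewrite !inE negb_or !(eq_sym z) nxz].
have : z \notin [:: x; y] by rewrite !inE negb_or !(eq_sym z) nxz.
elim: s z pz xs ys {yz nxz nyz zs} => [|a s IH] z /=.
  by rewrite andbT => zx _ _; exact: keep.
rewrite !inE !negb_or => /andP[za pa] /andP[xa xs] /andP[ya ys] nz.
apply: connect_trans (keep _ _ za _) _; first by rewrite !inE negb_or.
by apply: IH => //; rewrite !inE negb_or !(eq_sym a) xa ya.
Qed.

End Counting.

(** * Components after deleting the cut-edges *)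

Section Pruned.
Local Open Scope set_scope.
Implicit Types G : sgraph.

Notation pruned G := (del_edges (cut_edges G)).

Lemma components_partition G : partition (components G) [set: G].
Proof.
apply: equivalence_partitionP => x y z _ _ _.
exact: connect_equiv (@adj_sym G) x y z.
Qed.

Lemma components_closed G (C : {set G}) x y : C \in components G -> x \in C ->
  adj x y -> y \in C.
Proof.
case/imsetP => z _; rewrite classE => ->; rewrite !inE => zx xy.
exact: connect_trans zx (connect1 xy).
Qed.

Lemma darts_components G :
  darts [set: G] (@adj G) = \sum_(C in components G) darts C (@adj G).
Proof.
rewrite /darts (set_partition_big _ (components_partition G)) /=.
apply: eq_bigr => C CG; apply: eq_bigr => x xC; apply: eq_card => y.
rewrite !inE; case: (boolP (adj x y)) => [xy|]; last by rewrite !andbF.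
by rewrite (components_closed CG xC xy).
Qed.

(** The ends of an edge that is not a cut-edge stay connected when it is deleted
    together with the cut-edges, so they have a further neighbour. *)
Lemma pruned_component_neq2 G (C : {set pruned G}) : C \in components (pruned G) ->
  1 < #|C| -> 2 < #|C|.
Proof.
move=> CP /card_gt1P[x [y [xC yC nxy]]].
have symP := @adj_sym (pruned G).
have [z xz] : exists z, @adj (pruned G) x z.
  apply: connect_step nxy; case/imsetP: CP xC yC => a _; rewrite classE => ->.
  by rewrite !inE (sym_connect_sym symP); exact: connect_trans.
have /andP[xzG ncut] := xz.
have nxz : x != z by apply: contraTneq xzG => ->; rewrite adj_irrefl.
have [u /andP[xu]] := connect_step (connect_del_noncut xzG ncut) nxz.
rewrite in_setU1 negb_or => /andP[nu ncu].
have xuP : @adj (pruned G) x u by rewrite /= /del_adj xu.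
have nxu : x != u by apply: contraTneq xu => ->; rewrite adj_irrefl.
have nzu : z != u by apply: contraNneq nu => ->.
apply/card_gt2P; exists x, z, u; split; first split=> //.
- exact: (@components_closed (pruned G)) CP xC xz.
- exact: (@components_closed (pruned G)) CP xC xuP.
by split=> //; rewrite eq_sym.
Qed.

Lemma component_bound R G (C : {set pruned G}) :
  planar R G -> C \in components (pruned G) ->
  darts C (@adj (pruned G)) + 6 + 6 * (1 < #|C|) <= 6 * #|C|.
Proof.
move=> /planar_Z2_planar P CP.
have PP : Z2_planar (@adj (pruned G)).
  by apply: Z2_planar_sub P => x y /andP[].
have [C1|C1] := ltnP 1 #|C|.
  have := @darts_Z2_planar _ _ C (@adj_sym (pruned G)) (@adj_irrefl (pruned G)) PP.
  by move=> /(_ (pruned_component_neq2 CP C1)); lia.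
have C0 : 0 < #|C|.
  case/imsetP: CP => x _; rewrite classE => ->; apply/card_gt0P; exists x.
  by rewrite inE connect0.
have := @darts_le_sq _ C _ (@adj_irrefl (pruned G)).
have -> : #|C| = 1 by lia.
by lia.
Qed.

Lemma isomorphic_refl G : isomorphic G G.
Proof. by exists id => //; exists id. Qed.

(** When all components but [C] are singletons and [C] attains the planar bound,
    [C] is a maximal planar graph because the bound holds for every planar
    graph of its order. *)
Lemma class_H_intro R k G (C : {set pruned G}) : connected_graph G -> planar R G ->
  #|cut_edges G| = k.+1 -> C \in components (pruned G) -> 2 < #|C| ->
  (forall X, X \in components (pruned G) -> X != C -> #|X| = 1) ->
  6 * #|C| <= darts C (@adj (pruned G)) + 12 -> class_H R k G.
Proof.
move=> cG pG ck CP C3 single tight; split=> //.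
have cardP : #|components (pruned G)| = k.+2.
  by rewrite card_components_del_cut // cG ck.
pose s := enum (components (pruned G) :\ C).
have sizes : size s = k.+1.
  have := cardsD1 C (components (pruned G)).
  by rewrite cardP CP add1n -cardE => -[].
pose t := rcons s C.
have sizet : size t = k.+2 by rewrite size_rcons sizes.
have memt X : (X \in t) = (X \in components (pruned G)).
  rewrite mem_rcons in_cons mem_enum in_setD1.
  by case: eqP => // ->; rewrite CP.
have ut : uniq t.
  by rewrite rcons_uniq enum_uniq andbT mem_enum in_setD1 eqxx.
exists (fun i => nth C t i).
have inj : injective (fun i : 'I_k.+2 => nth C t i).
  by move=> i j /eqP; rewrite nth_uniq ?sizet // => /eqP/val_inj.
(* The enumeration ends with [C], the component of index [ord_max]. *)
have last : nth C t (@ord_max k.+1) = C by rewrite nth_rcons sizes /= ltnn eqxx.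
have mem_nth_t (i : 'I_k.+2) : nth C t i \in components (pruned G).
  by rewrite -memt mem_nth // sizet.
split=> //.
- have cardC : #|[set nth C t i | i : 'I_k.+2]| = k.+2 by rewrite card_imset // card_ord.
  apply/eqP; rewrite eqEcard cardC cardP leqnn andbT.
  by apply/subsetP => _ /imsetP[i _ ->].
- move=> i lt_i; apply: single; first exact: mem_nth_t.
  rewrite -[in X in _ != X]last nth_uniq ?sizet //.
  by rewrite neq_ltn lt_i.
- by rewrite last; exact: connected_induced_component.
rewrite last; split.
  apply: planar_hom pG; first exact: val_inj.
  by move=> x y /andP[].
move=> G' cardG' pG'; have := planar_edges pG'.
rewrite cardG' card_induced => /(_ C3).
have := @card_edges_induced (pruned G) C; lia.
Qed.

Lemma tree_intro G : connected_graph G ->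
  (forall C, C \in components (pruned G) -> #|C| <= 1) -> tree G.
Proof.
move=> cG small; split=> //; apply: acyclic_cut_edges.
apply/subsetP => f fG; apply: contraT => nf.
have : f \in edges (pruned G) by rewrite edges_del inE nf.
case/edgesP => x [y [xy _]].
have xC : x \in [set z | connect (@adj (pruned G)) x z] by rewrite inE connect0.
have CP : [set z | connect (@adj (pruned G)) x z] \in components (pruned G).
  by apply/imsetP; exists x; rewrite ?classE.
have := small _ CP; rewrite leqNgt => /negP[]; apply/card_gt1P.
exists x, y; split=> //; first exact: (@components_closed (pruned G)) CP xC xy.
by apply: contraTneq xy => ->; rewrite adj_irrefl.
Qed.
End Pruned.


Theorem theorem2p2 (R : realType) (n k : nat) (hn : 0 < n) (hk : 0 < k)
    (G : sgraph) (hconn : connected_graph G) (hplanar : planar R G)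
    (hord : #|G| = n) (m : nat) (hsize : #|edges G| = m)
    (hm : (3 * n%:Z - 2 * k%:Z - 9 < m%:Z)%R) :
  #|cut_edges G| <= k \/
  [\/ exists2 H : sgraph, class_H R k H & isomorphic G H,
      exists T : sgraph, [/\ tree T, #|T| = k + 2 & isomorphic G T] |
      exists T : sgraph, [/\ tree T, #|T| = k + 3 & isomorphic G T]].
Proof.
have {}hm : 3 * n < m + 2 * k + 9 by lia.
have [le_c|lt_c] := leqP #|cut_edges G| k; [by left|right].
move cutE: #|cut_edges G| lt_c => c lt_c.
pose P := del_edges (cut_edges G).
have cardP : #|components P| = c.+1.
  by rewrite card_components_del_cut // hconn cutE.
(* Kept opaque so that the arithmetic below sees it as an atom. *)
have [d dE] : exists d : {set P} -> nat, forall C, d C = darts C (@adj P).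
  by exists (fun C => darts C (@adj P)).
have bound C : C \in components P -> d C + 6 <= 6 * #|C|.
  move=> CP; rewrite dE; apply: leq_trans (component_bound hplanar CP).
  exact: leq_addr.
have bound2 C : C \in components P -> 1 < #|C| -> d C + 12 <= 6 * #|C|.
  by move=> CP C1; have := component_bound hplanar CP; rewrite C1 -dE -addnA.
have mE : 2 * m = 2 * c + \sum_(C in components P) d C.
  under eq_bigr do rewrite dE.
  rewrite -darts_components -(card_edges P) edges_del cardsD (setIidPr _); last first.
    by apply/subsetP => f; rewrite inE => /andP[].
  rewrite hsize cutE; have : c <= m; last by lia.
  rewrite -hsize -cutE; apply: subset_leq_card; apply/subsetP => f.
  by rewrite inE => /andP[].
have nE : n = \sum_(C in components P) #|C|.
  by rewrite -hord -cardsT (card_partition (components_partition P)).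
have [/exists_inP[C CP C1]|/exists_inPn small] :=
    boolP [exists C in components P, 1 < #|C|].
  constructor 1; exists G; last exact: isomorphic_refl.
  have C3 := pruned_component_neq2 CP C1.
  have weak (A : {set {set P}}) : A \subset components P ->
      \sum_(X in A) d X + 6 * #|A| <= 6 * \sum_(X in A) #|X|.
    move=> /subsetP sA; rewrite big_distrr /= mulnC -sum_nat_const -big_split /=.
    by apply: leq_sum => X /sA /bound.
  have splitC (F : {set P} -> nat) : \sum_(X in components P) F X =
      F C + \sum_(X in (components P :\ C)%SET) F X by rewrite (big_setD1 C CP).
  have cardB : #|(components P :\ C)%SET| = c.
    by have := cardsD1 C (components P); rewrite cardP CP add1n => -[].
  rewrite !splitC in nE mE.
  have bC := bound2 C CP C1.
  (* A second nontrivial component would leave 6 darts fewer, too few for the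
     number of edges. *)
  have single X : X \in components P -> X != C -> #|X| = 1.
    move=> XP nXC; have bX := bound X XP.
    have [X1|X1] := ltnP 1 #|X|; last by lia.
    have XB : X \in (components P :\ C)%SET by rewrite in_setD1 nXC.
    have := weak ((components P :\ C) :\ X)%SET.
    rewrite (subset_trans (subD1set _ _) (subD1set _ _)) => /(_ isT).
    have := cardsD1 X (components P :\ C)%SET; rewrite XB cardB.
    rewrite add1n => cR sumR; rewrite !(big_setD1 X XB) /= in nE mE.
    have arith (a b s r dC dX dR : nat) : n = a + (b + s) ->
        2 * m = 2 * c + (dC + (dX + dR)) -> dC + 12 <= 6 * a -> dX + 12 <= 6 * b ->
        c = r.+1 -> dR + 6 * r <= 6 * s -> False by clear -hm lt_c; lia.
    by case: (arith _ _ _ _ _ _ _ nE mE bC (bound2 X XP X1) cR sumR).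
  have d0 : \sum_(X in (components P :\ C)%SET) d X = 0.
    apply: big1 => X; rewrite in_setD1 => /andP[nXC XP].
    by have := bound X XP; rewrite (single X XP nXC); lia.
  have sumB : \sum_(X in (components P :\ C)%SET) #|X| = c.
    rewrite -[RHS]cardB -sum1_card; apply: eq_bigr => X.
    by rewrite in_setD1 => /andP[nXC XP]; apply: single.
  rewrite d0 sumB in nE mE.
  have cE : c = k.+1 by lia.
  have tight : 6 * #|C| <= d C + 12 by lia.
  by apply: (class_H_intro hconn hplanar (etrans cutE cE) CP C3 single); rewrite -dE.
have small1 C : C \in components P -> #|C| = 1 /\ d C = 0.
  by move=> CP; have := small _ CP; have := bound C CP; lia.
have n1 : n = c.+1.
  rewrite nE -cardP -sum1_card; apply: eq_bigr => C /small1[-> //].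
have D0 : \sum_(C in components P) d C = 0 by apply: big1 => C /small1[].
have tG : tree G by apply: tree_intro => // C /small1[->].
have : (c = k + 1 \/ c = k + 2)%N by move: hm; lia.
by case=> cE; [constructor 2|constructor 3]; exists G;
  (split=> //; [rewrite hord n1; lia|exact: isomorphic_refl]).
Qed.
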